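(* Let $(P,\preceq,\wedge,\mathbf{\hat 0}_P)$ be a locally finite meet semilattice with least element $\mathbf{\hat 0}_P$. Assume that there exists a sequence of finite sets $S_i\subset P$, $i\in\mathbb{Z}_+$, such that \[ P=\bigcup_{i=1}^\infty S_i . \] Then a function $f:P\to\mathbb{R}$ is positive definite if and only if \[ (f_r*_P\mu_P)(\mathbf{\hat 0}_P,x)\geq 0\quad\text{for all }x\in P, \] where $f_r$ is the restricted incidence function given by $f_r(\mathbf{\hat 0}_P,x)=f(x)$, $x\in P$.
   Context: A meet semilattice $(P,\preceq,\wedge)$ is a nonempty poset in which every two elements $x,y$ have a greatest lower bound $x\wedge y$. It is locally finite if every interval $\{z\in P\mid x\preceq z\preceq y\}$ is finite. The least element $\mathbf{\hat 0}_P$ satisfies $\mathbf{\hat 0}_P\preceq x$ for all $x\in P$. $\mathbb{Z}_+$ is the set of positive integers. For a finite nonempty set $S=\{x_1,\ldots,x_n\}\subset P$ and $f:P\to\mathbb{R}$, the meet matrix $(S)_f$ is the $n\times n$ matrix with entries $((S)_f)_{i,j}=f(x_i\wedge x_j)$. The function $f$ is called positive definite if $(S)_f$ is positive semidefinite for every finite nonempty $S\subset P$. The $P$-convolution of functions $f,g:P\times P\to\mathbb{R}$ is $(f*_Pg)(x,y)=\sum_{x\preceq z\preceq y}f(x,z)g(z,y)$. Let $\zeta_P(x,y)=1$ if $x\preceq y$ and $0$ otherwise. The Möbius function $\mu_P$ is the inverse of $\zeta_P$ under $*_P$ (the identity being $\delta_P(x,y)=1$ if $x=y$, $0$ otherwise).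 Thus $(f_r*_P\mu_P)(\mathbf{\hat 0}_P,x)=\sum_{z\preceq x}f(z)\mu_P(z,x)$; only the values of $f_r$ with first argument $\mathbf{\hat 0}_P$ are used. *)

(* Defs.v *)
From HB Require Import structures.
From mathcomp Require Import all_boot all_order all_algebra.
From mathcomp Require Import finmap.
From mathcomp Require Import all_classical all_reals.

Set Implicit Arguments.
Unset Strict Implicit.
Unset Printing Implicit Defensive.

Import Order.TTheory GRing.Theory Num.Theory.

Local Open Scope fset_scope.
Local Open Scope classical_set_scope.
Local Open Scope ring_scope.

Section LocallyFinite.
Context {d : Order.disp_t} {P : porderType d}.

Definition order_interval (x y : P) : set P := [set z | (x <= z <= y)%O].

Definition locally_finite : Prop :=
  forall x y : P, finite_set (order_interval x y).

End LocallyFinite.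

Arguments locally_finite {d} P.

Section IncidenceFunctions.
Context {d : Order.disp_t} {P : porderType d} {R : realType}.
Implicit Types f g h : P -> P -> R.

(* [\sum_(z \in A)] ranges over the support of the summand in [A], and is the
   ordinary finite sum when [P] is locally finite. *)
Definition convolution f g : P -> P -> R :=
  fun x y => \sum_(z \in order_interval x y) f x z * g z y.

Definition delta : P -> P -> R := fun x y => (x == y)%:R.

Definition zeta : P -> P -> R := fun x y => (x <= y)%O%:R.

(* [convolution f g x y] only reads [f] and [g] at comparable pairs, so inverses
   are unique only among functions vanishing outside [x <= y]. *)
Definition incidence_function f : Prop := forall x y, ~~ (x <= y)%O -> f x y = 0.

Definition convolution_inverse f g : Prop :=
  [/\ incidence_function g, convolution f g = delta & convolution g f = delta].

(* The default value [fun _ _ => 0] is not reached when [P] is locally finite: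
   see [mobiusP]. *)
Definition mobius : P -> P -> R :=
  xget (fun _ _ => 0) [set m | convolution_inverse zeta m].

End IncidenceFunctions.

(* Only the values at [(\bot, x)] are meaningful; the others are set to [0]. *)
Definition restricted_incidence {d : Order.disp_t} {P : bPOrderType d}
    {R : realType} (f : P -> R) : P -> P -> R :=
  fun x y => if x == \bot%O then f y else 0.

Definition psd_mx {R : realType} {n : nat} (A : 'M[R]_n) : Prop :=
  A^T = A /\ forall v : 'cV[R]_n, 0 <= (v^T *m A *m v) 0 0.

Section MeetMatrix.
Context {d : Order.disp_t} {P : meetSemilatticeType d} {R : realType}.

Definition meet_matrix (f : P -> R) {n : nat} (x : 'I_n -> P) : 'M[R]_n :=
  \matrix_(i < n, j < n) f (Order.meet (x i) (x j)).

(* A finite nonempty set [{x_1, ..., x_n}] is given by an injective family. *)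
Definition positive_definite (f : P -> R) : Prop :=
  forall (n : nat) (x : 'I_n -> P),
    (0 < n)%N -> injective x -> psd_mx (meet_matrix f x).

End MeetMatrix.

Section MobiusInverse.
Context {d : Order.disp_t} {P : porderType d} {R : realType}.
Implicit Types f g h : P -> P -> R.

Lemma in_order_interval (x y z : P) :
  (z \in order_interval x y) = (x <= z <= y)%O.
Proof. by apply/idP/idP => [/set_mem|?]; [|apply/mem_set]. Qed.

Lemma convolution_off f g x y : ~~ (x <= y)%O -> convolution f g x y = 0.
Proof.
move=> nxy; rewrite /convolution; apply: fsbig1 => z /andP[xz zy].
by rewrite (le_trans xz zy) in nxy.
Qed.

Lemma convolution_fset f g x y : locally_finite P ->
  convolution f g x y =
  \sum_(z <- fset_set (order_interval x y)) f x z * g z y.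
Proof. by move=> Pfin; rewrite /convolution fsbig_finite. Qed.

Lemma mem_fset_interval (x y z : P) : locally_finite P ->
  (z \in fset_set (order_interval x y)) = (x <= z <= y)%O.
Proof. by move=> Pfin; rewrite in_fset_set // in_order_interval. Qed.

Lemma sum_subinterval (F : P -> R) (x x' y y' : P) : locally_finite P ->
  (x <= x')%O -> (y' <= y)%O ->
  \sum_(z <- fset_set (order_interval x' y')) F z =
  \sum_(z <- fset_set (order_interval x y) | (x' <= z <= y')%O) F z.
Proof.
move=> Pfin xx' yy'; rewrite -[RHS]big_filter; apply: perm_big.
apply: uniq_perm; rewrite ?filter_uniq ?fset_uniq // => z.
rewrite mem_filter !mem_fset_interval //.
case: (boolP (x' <= z <= y')%O) => //= /andP[xz zy].
by rewrite (le_trans xx' xz) (le_trans zy yy').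
Qed.

Lemma convolutionA f g h : locally_finite P ->
  convolution (convolution f g) h = convolution f (convolution g h).
Proof.
move=> Pfin; apply/funext => x; apply/funext => y.
rewrite !convolution_fset //.
transitivity (\sum_(z <- fset_set (order_interval x y))
   \sum_(w <- fset_set (order_interval x y) | (x <= w <= z)%O)
     f x w * g w z * h z y).
  rewrite big_seq [RHS]big_seq; apply: eq_bigr => z.
  rewrite mem_fset_interval // => /andP[xz zy].
  by rewrite convolution_fset // (@sum_subinterval _ x x y z) // mulr_suml.
transitivity (\sum_(w <- fset_set (order_interval x y))
   \sum_(z <- fset_set (order_interval x y) | (w <= z <= y)%O)
     f x w * g w z * h z y); last first.
  rewrite big_seq [RHS]big_seq; apply: eq_bigr => w.
  rewrite mem_fset_interval // => /andP[xw wy].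
  rewrite convolution_fset // (@sum_subinterval _ x w y y) // mulr_sumr.
  by apply: eq_bigr => z _; rewrite mulrA.
under eq_bigr do rewrite big_mkcond.
under [RHS]eq_bigr do rewrite big_mkcond.
rewrite [RHS]exchange_big big_seq [RHS]big_seq /=; apply: eq_bigr => z.
rewrite mem_fset_interval // => /andP[_ zy].
rewrite big_seq [RHS]big_seq; apply: eq_bigr => w.
by rewrite mem_fset_interval // => /andP[xw _]; rewrite xw zy andbT.
Qed.

Lemma convolution_delta f :
  locally_finite P -> incidence_function f -> convolution f delta = f.
Proof.
move=> Pfin fI; apply/funext => x; apply/funext => y.
case: (boolP (x <= y)%O) => xy; last by rewrite convolution_off // fI.
rewrite convolution_fset // (big_fsetD1 y) ?mem_fset_interval ?xy ?lexx //=.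
rewrite /delta eqxx mulr1 big_seq big1 ?addr0 // => z.
by rewrite !inE => /andP[/negbTE -> _]; rewrite mulr0.
Qed.

Lemma delta_convolution f :
  locally_finite P -> incidence_function f -> convolution delta f = f.
Proof.
move=> Pfin fI; apply/funext => x; apply/funext => y.
case: (boolP (x <= y)%O) => xy; last by rewrite convolution_off // fI.
rewrite convolution_fset // (big_fsetD1 x) ?mem_fset_interval ?xy ?lexx //=.
rewrite /delta eqxx mul1r big_seq big1 ?addr0 // => z.
by rewrite !inE eq_sym => /andP[/negbTE -> _]; rewrite mul0r.
Qed.

Lemma card_subinterval (x y z : P) : locally_finite P ->
  (x <= z)%O -> (z < y)%O ->
  (#|` fset_set (order_interval x z)| < #|` fset_set (order_interval x y)|)%N.
Proof.
move=> Pfin xz zy; apply: fproper_ltn_card; apply/andP; split.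
  apply/fsubsetP => w; rewrite !mem_fset_interval // => /andP[-> wz] /=.
  exact: le_trans wz (ltW zy).
apply/fsubsetP => /(_ y); rewrite !mem_fset_interval // (le_trans xz (ltW zy)).
by rewrite lexx /= => /(_ isT) /(lt_le_trans zy); rewrite ltxx.
Qed.

Fixpoint left_inverse_rec h (n : nat) (x y : P) : R :=
  if n is n'.+1 then
    if x == y then 1 else
    if (x < y)%O then
      - \sum_(z <- fset_set (order_interval x y) | z != y)
          left_inverse_rec h n' x z * h z y
    else 0
  else 0.

Lemma left_inverse_rec_stable h n m (x y : P) : locally_finite P ->
  (#|` fset_set (order_interval x y)| <= n)%N -> (n <= m)%N ->
  left_inverse_rec h m x y = left_inverse_rec h n x y.
Proof.
move=> Pfin; elim: n m y => [|n IH] [|m] y //=.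
- rewrite leqn0 cardfs_eq0 => /eqP xy0 _.
  have nxy : ~~ (x <= y)%O.
    by have := mem_fset_interval x y x Pfin; rewrite xy0 inE lexx => /= <-.
  case: eqVneq => [xy|_]; first by rewrite xy lexx in nxy.
  by case: ifP => // /ltW xy; rewrite xy in nxy.
- move=> cn nm; case: eqVneq => // xy'; case: ifP => // xy.
  congr (- _); rewrite big_seq_cond [RHS]big_seq_cond; apply: eq_bigr => z.
  rewrite mem_fset_interval // => /andP[/andP[xz zy] zNy].
  rewrite (IH m) // -ltnS; apply: leq_trans cn; apply: card_subinterval => //.
  by rewrite lt_neqAle zNy.
Qed.

Lemma convolution_left_inverse h : locally_finite P -> (forall x, h x x = 1) ->
  exists g, [/\ incidence_function g, forall x, g x x = 1
              & convolution g h = delta].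
Proof.
move=> Pfin h1.
pose g x y := left_inverse_rec h #|` fset_set (order_interval x y)|.+1 x y.
have g1 x : g x x = 1 by rewrite /g /= eqxx.
exists g; split=> //.
  move=> x y nxy; rewrite /g /=.
  case: eqVneq => [xy|_]; first by rewrite xy lexx in nxy.
  by case: ifP => // /ltW xy; rewrite xy in nxy.
apply/funext => x; apply/funext => y; rewrite /delta.
case: (boolP (x <= y)%O) => xy; last first.
  by rewrite convolution_off //; case: eqVneq xy => // ->; rewrite lexx.
rewrite convolution_fset // (bigD1_seq y) ?mem_fset_interval ?xy ?lexx
  ?fset_uniq //=.
rewrite h1 mulr1; case: eqVneq => [<-|xNy].
  rewrite g1 big_seq_cond big1 ?addr0 // => z.
  rewrite mem_fset_interval // => /andP[/le_anti ->].
  by rewrite eqxx.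
have ltxy : (x < y)%O by rewrite lt_neqAle xNy.
rewrite {1}/g /= (negbTE xNy) ltxy; apply/eqP; rewrite addrC subr_eq0; apply/eqP.
rewrite big_seq_cond [RHS]big_seq_cond; apply: eq_bigr => z.
rewrite mem_fset_interval // => /andP[/andP[xz zy] zNy]; congr (_ * _).
have ltzy : (z < y)%O by rewrite lt_neqAle zNy.
have czy := card_subinterval Pfin xz ltzy.
by rewrite /g (@left_inverse_rec_stable h _ _ x z Pfin (leqnSn _) czy).
Qed.

Lemma mobiusP :
  locally_finite P -> convolution_inverse zeta (mobius : P -> P -> R).
Proof.
move=> Pfin; apply: (@xgetPex _ _ [set m | convolution_inverse zeta m]).
have zI : incidence_function (zeta : P -> P -> R).
  by move=> x y /negbTE; rewrite /zeta => ->.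
have z1 (x : P) : zeta x x = 1 :> R by rewrite /zeta lexx.
have [l [lI l1 lz]] := convolution_left_inverse Pfin z1.
have [m [mI _ ml]] := convolution_left_inverse Pfin l1.
exists l; split=> //; suff -> : zeta = m by [].
by rewrite -(delta_convolution Pfin zI) -ml convolutionA // lz convolution_delta.
Qed.

Lemma convolution_inverse_unique f g g' : locally_finite P ->
  convolution_inverse f g -> convolution_inverse f g' -> g = g'.
Proof.
move=> Pfin [gI _ gf] [gI' fg' _].
by rewrite -(convolution_delta Pfin gI) -fg' -convolutionA // gf delta_convolution.
Qed.

End MobiusInverse.

(* Main.v *)
(** Write [g x = (f_r * mu)(0, x)]; Möbius inversion gives [f x = \sum_(z <= x) g z].
    Since [z <= x_i /\ x_j] iff [z <= x_i] and [z <= x_j], the quadratic form of a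
    meet matrix is [\sum_z g z * (\sum_(i | z <= x_i) v_i)^2], which is nonnegative
    when [g] is. Conversely, for [S = [0, x]] and [v_z = mu(z, x)] the inner sum is
    [(zeta * mu)(z, x) = delta(z, x)], so the quadratic form takes the value [g x]. *)
Require Import Defs.
From HB Require Import structures.
From mathcomp Require Import all_boot all_order all_algebra.
From mathcomp Require Import finmap.
From mathcomp Require Import all_classical all_reals.

Import Order.TTheory GRing.Theory Num.Theory.

Local Open Scope classical_set_scope.
Local Open Scope ring_scope.

Lemma restricted_incidence_function (R : realType) (d : Order.disp_t)
    (P : bPOrderType d) (f : P -> R) :
  incidence_function (restricted_incidence f).
Proof.
move=> x y; rewrite /restricted_incidence.
by case: eqVneq => [->|//]; rewrite le0x.
Qed.

(** By associativity [f_r = f_r * (mu * zeta) = (f_r * mu) * zeta]; evaluated at [(\bot, x)], the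
    factor [zeta z x] is 1 on the whole interval. *)
Lemma mobius_inversion (R : realType) (d : Order.disp_t) (P : bPOrderType d)
    (f : P -> R) (x : P) : locally_finite P ->
  f x = \sum_(z <- fset_set (order_interval \bot%O x))
          convolution (restricted_incidence f) mobius \bot%O z.
Proof.
move=> Pfin; have [_ _ muz] := mobiusP (R := R) Pfin.
have <- : restricted_incidence f \bot%O x = f x.
  by rewrite /restricted_incidence eqxx.
rewrite -[in LHS](convolution_delta Pfin (@restricted_incidence_function _ _ _ f)).
rewrite -muz -convolutionA // [LHS]convolution_fset //.
rewrite big_seq [RHS]big_seq; apply: eq_bigr => z.
by rewrite mem_fset_interval // => /andP[_ zx]; rewrite /zeta zx mulr1.
Qed.

(** A common index set [D] for all entries lets the sums be exchanged. It may exceed the union of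
    the down-sets of the [x i]: any other [z] has an empty inner sum and contributes 0. *)
Lemma meet_matrix_quadratic_form (R : realType) (d : Order.disp_t)
    (P : bMeetSemilatticeType d) (f : P -> R) (n : nat) (x : 'I_n -> P)
    (v : 'cV[R]_n) (D : {fset P}) : locally_finite P ->
  (forall i z, (z <= x i)%O -> z \in D) ->
  (v^T *m meet_matrix f x *m v) 0 0 =
  \sum_(z <- D) convolution (restricted_incidence f) mobius \bot%O z *
                (\sum_(i < n | (z <= x i)%O) v i 0) ^+ 2.
Proof.
move=> Pfin xD; set g := convolution _ _ _.
have fE i j : f (Order.meet (x i) (x j)) =
    \sum_(z <- D) g z * ((z <= x i)%O%:R * (z <= x j)%O%:R).
  rewrite (mobius_inversion _ _ _ _ _ Pfin).
  transitivity (\sum_(z <- D | (z <= Order.meet (x i) (x j))%O) g z); last first.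
    rewrite big_mkcond; apply: eq_bigr => z _; rewrite lexI.
    by case: (z <= x i)%O; case: (z <= x j)%O; rewrite /= !(mulr1, mul0r, mulr0).
  rewrite -[RHS]big_filter; apply: perm_big.
  apply: uniq_perm; rewrite ?filter_uniq ?fset_uniq // => z.
  rewrite mem_filter mem_fset_interval // le0x /= lexI.
  by case: (boolP (z <= x i)%O) => //= /xD ->; rewrite andbT.
transitivity (\sum_(j < n) \sum_(i < n) \sum_(z <- D)
    g z * (((z <= x i)%O%:R * v i 0) * ((z <= x j)%O%:R * v j 0))).
  rewrite mxE; apply: eq_bigr => j _; rewrite mxE mulr_suml; apply: eq_bigr => i _.
  rewrite !mxE fE mulr_sumr mulr_suml; apply: eq_bigr => z _.
  by rewrite mulrCA -!mulrA; congr (_ * _); rewrite mulrCA; congr (_ * _); rewrite mulrCA.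
(* With [z] outermost, the double sum over [i] and [j] factors into a square. *)
under eq_bigr do rewrite exchange_big /=.
rewrite exchange_big /=; apply: eq_bigr => z _.
have -> : \sum_(i < n | (z <= x i)%O) v i 0 = \sum_(i < n) (z <= x i)%O%:R * v i 0.
  rewrite big_mkcond; apply: eq_bigr => i _.
  by case: (z <= x i)%O; rewrite ?mul1r ?mul0r.
rewrite expr2 mulr_sumr mulr_sumr; apply: eq_bigr => j _.
by rewrite -mulr_sumr -mulr_suml.
Qed.

Lemma tr_meet_matrix (R : realType) (d : Order.disp_t)
    (P : meetSemilatticeType d) (f : P -> R) (n : nat) (x : 'I_n -> P) :
  (meet_matrix f x)^T = meet_matrix f x.
Proof. by apply/matrixP => i j; rewrite !mxE meetC. Qed.

Theorem theorem2p5 (R : realType) (d : Order.disp_t)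
    (P : bMeetSemilatticeType d)
    (Pfin : locally_finite P)
    (Pcount : exists S : nat -> set P,
        (forall i : nat, (1 <= i)%N -> finite_set (S i)) /\
        [set: P] = \bigcup_(i >= 1) S i)
    (f : P -> R) :
  positive_definite f <->
  (forall x : P, 0 <= convolution (restricted_incidence f) mobius \bot%O x).
Proof.
split=> [fpd x|g_ge0 n x _ _]; last first.
  split=> [|v]; first exact: tr_meet_matrix.
  (* Down-sets are intervals from [\bot], so local finiteness makes this union a valid choice of
     [D]. *)
  have Dfin : finite_set (\bigcup_(i in [set: 'I_n]) order_interval \bot%O (x i)).
    by apply: bigcup_finite => // i _; exact: Pfin.
  rewrite (@meet_matrix_quadratic_form _ _ _ _ _ _ _ (fset_set
    (\bigcup_(i in [set: 'I_n]) order_interval \bot%O (x i)))) //.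
    by apply: sumr_ge0 => z _; rewrite mulr_ge0 ?sqr_ge0.
  move=> i z zx; rewrite in_fset_set //; apply/mem_set.
  by exists i => //; rewrite /order_interval /= le0x.
have [_ zmu _] := mobiusP (R := R) Pfin.
set D := fset_set (order_interval \bot%O x).
have DE z : (z \in D) = (z <= x)%O by rewrite mem_fset_interval // le0x.
(* [s] lists the down-set of [x] without repetition, as the injective family to which positive
   definiteness is applied. *)
pose s := tnth (in_tuple D).
pose v : 'cV[R]_(size D) := \col_i mobius (s i) x.
have s_inj : injective s by apply/tuple_uniqP; exact: fset_uniq.
have sD i : s i \in D by exact: mem_tnth.
have D_gt0 : (0 < size D)%N.
  by rewrite cardfs_gt0; apply/fset0Pn; exists x; rewrite DE.
have [_ /(_ v)] := fpd _ _ D_gt0 s_inj.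
rewrite (@meet_matrix_quadratic_form _ _ _ _ _ _ _ D) //; last first.
  by move=> i z /le_trans zs; rewrite DE zs // -DE.
(* Given this, only the term [z = x] survives in the quadratic form. *)
suff innerE z : \sum_(i < size D | (z <= s i)%O) v i 0 = (z == x)%:R.
  rewrite (big_fsetD1 x) ?DE ?lexx //= innerE eqxx expr1n mulr1.
  rewrite big_seq big1 ?addr0 // => z.
  by rewrite innerE !inE => /andP[/negbTE -> _]; rewrite expr0n mulr0.
rewrite -[RHS]/(delta z x) -zmu convolution_fset //.
(* The convolution runs over [[z, x]]; viewing it as a filtered sum over [[\bot, x]] matches it with
   the enumeration [s] of [D]. *)
rewrite (@sum_subinterval _ _ _ _ \bot%O z x x) ?le0x //.
rewrite -/D [in RHS](big_tnth _ _ D) /=.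
apply: eq_big => [i|i zs]; first by rewrite -[tnth _ i]/(s i) -(DE (s i)) sD andbT.
by rewrite mxE /zeta -[tnth _ i]/(s i) zs mul1r.
Qed.
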